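(* Let $F$ be an absolutely continuous distribution function on $\mathbb{R}$ with $F(z)=0$ for $z<0$, increasing on $[0,\infty)$. Let $m,n\ge 1$, $N=m+n$, and let $Z_1,\ldots,Z_N$ be independent random variables such that $Z_1,\ldots,Z_m$ have distribution function $G_\Delta^{(1)}$ and $Z_{m+1},\ldots,Z_N$ have distribution function $G_\Delta^{(2)}$. Let $R_1,\ldots,R_N$ be the ranks of $Z_1,\ldots,Z_N$ in the pooled sample. Then the joint distribution of $(R_1,\ldots,R_N)$ does not depend on $F$ in each of the following cases: (0) the hypothesis: $G_\Delta^{(1)}=G_\Delta^{(2)}=F$; (A) $G_\Delta^{(1)}(z)=F(z)$ and $G_\Delta^{(2)}(z)=(1-\Delta)F(z)+\Delta F^2(z)$ for $z\ge0$, with $0<\Delta<1$; (B) $G_\Delta^{(1)}(z)=1-(1-F(z))^{1+\Delta}$ and $G_\Delta^{(2)}(z)=(F(z))^{1+\Delta}$ for $z\ge 0$, with $\Delta>0$; (C) $G_\Delta^{(1)}(z)=F(z)$ and $G_\Delta^{(2)}(z)=(F(z))^{1+\Delta}$ for $z\ge 0$, with $\Delta>0$. (That is, in each of the cases (A), (B), (C), for fixed $m,n,\Delta$ the distribution of the ranks is the same for all such $F$, and in case (0) for fixed $m,n$.) Consequently, the power function (as a function of $\Delta$) of every rank test against each of the alternatives (A), (B), (C) does not depend on $F$.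
   Context: All distribution functions $G_\Delta^{(1)},G_\Delta^{(2)}$ vanish on $(-\infty,0)$. The rank of $Z_i$ is $R_i=\#\{j\in\{1,\ldots,N\}: Z_j\le Z_i\}$; ties occur with probability zero since all distribution functions involved are continuous. A rank test is a (possibly randomized) test whose test function, with values in $[0,1]$, is a function of $(R_1,\ldots,R_N)$ only; its power at a given alternative is the expectation of the test function under that alternative. *)

(* Defs.v *)
From HB Require Import structures.
From mathcomp Require Import all_boot all_order all_algebra.
From mathcomp Require Import all_classical all_reals all_analysis.
From mathcomp Require Import measurable_realfun.
Import Order.TTheory GRing.Theory Num.Theory.
Import numFieldNormedType.Exports.

Set Implicit Arguments.
Unset Strict Implicit.
Unset Printing Implicit Defensive.

Local Open Scope classical_set_scope.
Local Open Scope ring_scope.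

(* [F : cumulativeBounded 0 1] is a distribution function on the real line:
   nondecreasing, right-continuous, with limits 0 at -oo and 1 at +oo.
   It is absolutely continuous when the law it determines is absolutely
   continuous with respect to the Lebesgue measure. *)
Definition abs_continuous_cdf (R : realType)
    (F : cumulativeBounded (0 : R) (1 : R)) : Prop :=
  lebesgue_stieltjes_measure F `<< (@lebesgue_measure R).

(* A distribution function is nondecreasing by definition: "increasing on
   [0, +oo)" is read as strictly increasing there. *)
Definition baseline_cdf (R : realType)
    (F : cumulativeBounded (0 : R) (1 : R)) : Prop :=
  [/\ abs_continuous_cdf F,
      forall z : R, z < 0 -> F z = 0 &
      forall x y : R, 0 <= x -> x < y -> F x < F y].

Definition mutually_independent (d : measure_display) (T : measurableType d)
    (R : realType) (P : probability T R) (I : finType)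
    (X : I -> {RV P >-> R}) : Prop :=
  forall (J : {set I}) (B : I -> set R), (forall i, measurable (B i)) ->
    P (\bigcap_(i in [set` J]) (X i @^-1` B i)) =
    (\prod_(i in J) P (X i @^-1` B i))%E.

(* The sample is indexed by ['I_(m + n)]: [lshift n i] enumerates the first m
   observations and [rshift m j] the last n. *)
Definition two_sample (d : measure_display) (T : measurableType d)
    (R : realType) (P : probability T R) (m n : nat) (G1 G2 : R -> R)
    (Z : 'I_(m + n) -> {RV P >-> R}) : Prop :=
  [/\ mutually_independent Z,
      forall (i : 'I_m) (z : R), cdf (Z (lshift n i)) z = (G1 z)%:E &
      forall (j : 'I_n) (z : R), cdf (Z (rshift m j)) z = (G2 z)%:E].

Definition rank (R : realType) (N : nat) (z : 'I_N -> R) (i : 'I_N) : nat :=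
  #|[pred j : 'I_N | z j <= z i]|.

Definition rank_vector (d : measure_display) (T : measurableType d)
    (R : realType) (P : probability T R) (N : nat)
    (Z : 'I_N -> {RV P >-> R}) (w : T) : N.-tuple nat :=
  [tuple rank (fun j => Z j w) i | i < N].

Section rank_vector_measurable.
Context (d : measure_display) (T : measurableType d) (R : realType).
Context (P : probability T R) (N : nat).
Variable Z : 'I_N -> {RV P >-> R}.

Let measurable_rank (i : 'I_N) :
  measurable_fun [set: T] (fun w => rank (fun j => Z j w) i).
Proof.
have -> : (fun w => rank (fun j => Z j w) i) =
    (fun w => \sum_(j <- enum 'I_N) nat_of_bool (Z j w <= Z i w)%R)%N.
  apply/funext => w; rewrite /rank -sum1_card big_mkcond/= big_enum/=.
  by apply: eq_bigr => j _; rewrite inE; case: ifP.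
elim: (enum 'I_N) => [|j s ih].
  rewrite (_ : (fun _ => _) = cst 0%N); first exact: measurable_cst.
  by apply/funext => w; rewrite big_nil.
rewrite (_ : (fun _ => _) = (fun w => nat_of_bool (Z j w <= Z i w)%R +
    \sum_(j <- s) nat_of_bool (Z j w <= Z i w)%R)%N); last first.
  by apply/funext => w; rewrite big_cons.
apply: measurable_fun_addn => //.
apply: (@measurableT_comp _ _ _ _ _ _ nat_of_bool _
  (fun w => Z j w <= Z i w)) => //.
exact: measurable_fun_ler.
Qed.

Let measurable_rank_vector : measurable_fun [set: T] (rank_vector Z).
Proof.
apply/measurable_fun_tnthP => i.
rewrite (_ : _ \o _ = fun w => rank (fun j => Z j w) i)//.
by apply/funext => w /=; rewrite tnth_mktuple.
Qed.

HB.instance Definition _ :=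
  @isMeasurableFun.Build _ _ _ _ (rank_vector Z) measurable_rank_vector.

End rank_vector_measurable.

Inductive alternative := AltA | AltB | AltC.

Definition alt_range (R : realType) (a : alternative) (Delta : R) : Prop :=
  match a with
  | AltA => 0 < Delta < 1
  | AltB | AltC => 0 < Delta
  end.

Definition vanish_neg (R : realType) (g : R -> R) (z : R) : R :=
  if z < 0 then 0 else g z.

Definition alt_G1 (R : realType) (a : alternative) (Delta : R) (F : R -> R) :
    R -> R :=
  vanish_neg (fun z =>
    match a with
    | AltA => F z
    | AltB => 1 - (1 - F z) `^ (1 + Delta)
    | AltC => F z
    end).

Definition alt_G2 (R : realType) (a : alternative) (Delta : R) (F : R -> R) :
    R -> R :=
  vanish_neg (fun z =>
    match a with
    | AltA => (1 - Delta) * F z + Delta * F z ^+ 2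
    | AltB => F z `^ (1 + Delta)
    | AltC => F z `^ (1 + Delta)
    end).

(* The joint law of the ranks is the same for any two baseline distribution
   functions [F] and [F'], whatever probability spaces carry the samples. *)
Definition rank_law_free (R : realType) (m n : nat)
    (G1 G2 : (R -> R) -> R -> R) : Prop :=
  forall F F' : cumulativeBounded (0 : R) (1 : R),
  baseline_cdf F -> baseline_cdf F' ->
  forall (d : measure_display) (T : measurableType d) (P : probability T R)
         (Z : 'I_(m + n) -> {RV P >-> R}),
  two_sample (G1 F) (G2 F) Z ->
  forall (d' : measure_display) (T' : measurableType d')
         (P' : probability T' R) (Z' : 'I_(m + n) -> {RV P' >-> R}),
  two_sample (G1 F') (G2 F') Z' ->
  forall A : set ((m + n).-tuple nat), measurable A ->
    distribution P (rank_vector Z) A = distribution P' (rank_vector Z') A.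

(* The test function of a randomized rank test; its values at tuples that are
   not rank vectors are irrelevant. *)
Definition rank_test (R : realType) (N : nat) (phi : N.-tuple nat -> R) : Prop :=
  forall r, 0 <= phi r <= 1.

Definition power_function (R : realType) (m n : nat)
    (phi : (m + n).-tuple nat -> R) (a : alternative)
    (F : cumulativeBounded (0 : R) (1 : R)) (beta : R -> R) : Prop :=
  forall Delta : R, alt_range a Delta ->
  forall (d : measure_display) (T : measurableType d) (P : probability T R)
         (Z : 'I_(m + n) -> {RV P >-> R}),
  two_sample (alt_G1 a Delta F) (alt_G2 a Delta F) Z ->
  ('E_P[phi \o rank_vector Z] = (beta Delta)%:E)%E.

(* Main.v *)
(** Since [F] has no atoms, [F] maps [0, +oo) increasingly onto [0, 1), so for
    [u] in [0, 1) and [G = h \o F] the variable [F (Z_i)] has distribution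
    function [h u], whatever [F] is. Independence then makes the joint law of
    [(F (Z_1), ..., F (Z_N))] free of [F], and so is the law of the ranks, which
    an increasing transformation leaves unchanged. In each of the cases (0), (A),
    (B), (C) both distribution functions are of the form [h \o F]. *)
From HB Require Import structures.
Require Import Defs.
From mathcomp Require Import all_boot all_order all_algebra.
From mathcomp Require Import all_classical all_reals all_analysis.
From mathcomp Require Import measurable_realfun.
From mathcomp Require Import lra.
Import Order.TTheory GRing.Theory Num.Theory.
Import numFieldNormedType.Exports.

Set Implicit Arguments.
Unset Strict Implicit.
Unset Printing Implicit Defensive.

Local Open Scope classical_set_scope.
Local Open Scope ring_scope.

(** * Laws determined by distribution functions, on the line and for independent families *)

(** The rays []x, +oo[] generate the Borel sets and are stable under intersection, and the mass of
    each one is the complement of a value of the cdf. *)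
Lemma distribution_eq_cdf (R : realType)
    (d : measure_display) (T : measurableType d) (P : probability T R)
    (d' : measure_display) (T' : measurableType d') (P' : probability T' R)
    (X : {RV P >-> R}) (X' : {RV P' >-> R}) :
  cdf X =1 cdf X' ->
  forall B : set R, measurable B -> distribution P X B = distribution P' X' B.
Proof.
move=> XX'; apply: (measure_unique (@RGenOInfty.G R)
  (fun k : nat => `](- k%:R), +oo[%classic)).
- exact: RGenOInfty.measurableE.
- move=> _ _ [x ->] [y ->]; exists (Order.max x y).
  by apply/seteqP; split => z /=; rewrite !in_itv/= !andbT gt_max => /andP.
- by move=> k; exists (- k%:R).
- rewrite -subTset => x _; exists (Num.bound x) => //=.
  by rewrite in_itv/= andbT ltrNl unstable.ltrNbound.
- by move=> _ [r ->]; have := ccdf_1_cdf X r; rewrite XX' -ccdf_1_cdf.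
- move=> k; rewrite (@le_lt_trans _ _ 1%E) ?ltry//.
  exact: probability_le1.
Qed.

Section joint.
Context (d : measure_display) (T : measurableType d) (R : realType).
Context (P : probability T R) (N : nat).
Variable X : 'I_N -> {RV P >-> R}.

Definition joint (w : T) : N.-tuple R := [tuple X i w | i < N].

Let measurable_joint : measurable_fun [set: T] joint.
Proof.
apply/measurable_fun_tnthP => i.
by rewrite (_ : _ \o _ = X i)//; apply/funext => w /=; rewrite tnth_mktuple.
Qed.

HB.instance Definition _ :=
  @isMeasurableFun.Build _ _ _ _ joint measurable_joint.

(** Puts box events in the form used by [mutually_independent], with the full index set as [J]. *)
Lemma preimage_joint_box (B : 'I_N -> set R) :
  joint @^-1` [set x | forall i, B i (tnth x i)] =
  \bigcap_(i in [set` [set: 'I_N]%SET]) (X i @^-1` B i).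
Proof.
apply/seteqP; split => w /= Bw i.
  by move=> _; have := Bw i; rewrite tnth_mktuple.
by rewrite tnth_mktuple; apply: Bw => /=; rewrite inE.
Qed.

End joint.

Definition boxes (T : Type) (N : nat) (M : set (set T)) : set (set (N.-tuple T)) :=
  [set E | exists2 B : 'I_N -> set T, (forall i, M (B i)) &
     E = [set x | forall i, B i (tnth x i)]].

(** A cylinder over one coordinate is a box whose other sides are full, and a box is a finite
    intersection of cylinders. Boxes are preferred as generators because they are stable under
    intersection. *)
Lemma measurable_tuple_boxes (d : measure_display) (T : measurableType d) (N : nat) :
  (measurable : set (set (N.-tuple T))) = <<s boxes (d.-measurable : set (set T)) >>.
Proof.
apply/seteqP; split.
- apply: smallest_sub; first exact: smallest_sigma_algebra.
  rewrite -bigcup_seq => A [i _ [B mB <-]].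
  apply: sub_sigma_algebra; exists (fun j => if j == i then B else setT).
    by move=> j; case: ifP.
  apply/seteqP; split => x /=.
    by move=> [_ Bx] j; case: eqVneq => // ->.
  by move=> /(_ i); rewrite eqxx.
- apply: smallest_sub; first exact: sigma_algebra_measurable.
  move=> _ [B mB ->].
  rewrite (_ : mkset _ = \bigcap_(i in [set: 'I_N])
      ((fun x : N.-tuple T => tnth x i) @^-1` B i)); last first.
    by apply/seteqP; split => x /= Bx i => [_|]; exact: Bx.
  apply: fin_bigcap_measurable => // i _.
  by rewrite -[X in measurable X]setTI; exact: measurable_tnth.
Qed.

Lemma boxesI (d : measure_display) (T : measurableType d) (N : nat) :
  setI_closed (boxes (N := N) (d.-measurable : set (set T))).
Proof.
move=> _ _ [A mA ->] [B mB ->]; exists (fun i => A i `&` B i).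
  by move=> i; exact: measurableI.
apply/seteqP; split => x /= => [[Ax Bx] i //|ABx].
by split => i; have [] := ABx i.
Qed.

(** By independence the mass of a box is a product of marginal masses, each fixed by a cdf;
    agreement on the boxes then extends to all measurable sets. *)
Lemma joint_law_eq (R : realType) (N : nat)
    (d : measure_display) (T : measurableType d) (P : probability T R)
    (d' : measure_display) (T' : measurableType d') (P' : probability T' R)
    (X : 'I_N -> {RV P >-> R}) (X' : 'I_N -> {RV P' >-> R}) :
  mutually_independent X -> mutually_independent X' ->
  (forall i, cdf (X i) =1 cdf (X' i)) ->
  forall E : set (N.-tuple R), measurable E ->
    distribution P (joint X) E = distribution P' (joint X') E.
Proof.
move=> iX iX' XX'.
apply: (measure_unique (boxes measurable) (fun=> setT)).
- exact: measurable_tuple_boxes.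
- exact: boxesI.
- by move=> _; exists (fun=> setT) => //; apply/seteqP; split.
- by rewrite bigcup_const//; exists 0%N.
- move=> _ [B mB ->].
  transitivity (\prod_(i in [set: 'I_N]%SET) distribution P (X i) (B i))%E.
    by rewrite -iX// -preimage_joint_box.
  transitivity (\prod_(i in [set: 'I_N]%SET) distribution P' (X' i) (B i))%E;
    last by rewrite -iX'// -preimage_joint_box.
  by apply: eq_bigr => i _; exact: distribution_eq_cdf.
- by move=> k; rewrite (@le_lt_trans _ _ 1%E) ?ltry//; exact: probability_le1.
Qed.

Lemma mutually_independent_comp (d : measure_display) (T : measurableType d)
    (R : realType) (P : probability T R) (I : finType)
    (X : I -> {RV P >-> R}) (f : {mfun R >-> R}) :
  mutually_independent X ->
  mutually_independent (fun i => f \o X i : {RV P >-> R}).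
Proof.
move=> iX J B mB; apply: (iX J (fun i => f @^-1` B i)) => i.
by rewrite -[X in measurable X]setTI; exact: measurable_funPT.
Qed.

(** * Ranks as a function of the joint vector, and their invariance under increasing maps *)

Lemma rank_mono (R : realType) (N : nat) (f : R -> R) (z : 'I_N -> R) :
  {mono f : x y / x <= y} -> rank (f \o z) =1 rank z.
Proof. by move=> fm i; apply: eq_card => j; rewrite !inE /= fm. Qed.

Section rank_tuple.
Context (R : realType) (N : nat).

Definition rank_tuple (x : N.-tuple R) : N.-tuple nat :=
  [tuple rank (tnth x) i | i < N].

(* [rank_tuple] is the rank vector of the coordinate variables; the Dirac
   measure only serves to regard them as random variables. *)
Lemma measurable_rank_tuple : measurable_fun [set: N.-tuple R] rank_tuple.
Proof.
pose P := dirac [tuple (0 : R) | i < N] : probability _ R.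
pose Z (i : 'I_N) : {RV P >-> R} :=
  mfun_Sub (mem_set (measurable_tnth (T := R) i)).
exact: (measurable_funPT (rank_vector Z)).
Qed.

Lemma rank_vector_joint (d : measure_display) (T : measurableType d)
    (P : probability T R) (Z : 'I_N -> {RV P >-> R}) :
  rank_vector Z = rank_tuple \o joint Z.
Proof.
apply/funext => w; apply: eq_from_tnth => i; rewrite !tnth_mktuple.
by apply: eq_card => j; rewrite !inE !tnth_mktuple.
Qed.

End rank_tuple.

Lemma rank_vector_mono (d : measure_display) (T : measurableType d)
    (R : realType) (P : probability T R) (N : nat) (Z : 'I_N -> {RV P >-> R})
    (f : {mfun R >-> R}) : {mono f : x y / x <= y} ->
  rank_vector (fun i => f \o Z i : {RV P >-> R}) = rank_vector Z.
Proof.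
move=> fm; apply/funext => w; apply: eq_from_tnth => i.
by rewrite !tnth_mktuple; exact: (rank_mono (fun j => Z j w) fm).
Qed.

(** * Baseline distribution functions and the rescaling of the sample by them *)

Section cumulative_bounded.
Context (R : realType) (F : cumulativeBounded (0 : R) (1 : R)).

Lemma lebesgue_stieltjes_itvNyc (z : R) :
  lebesgue_stieltjes_measure F `]-oo, z] = (F z)%:E.
Proof. exact: cdf_lebesgue_stieltjes_id. Qed.

Lemma cumulativeBounded_ge0 (z : R) : 0 <= F z.
Proof. by rewrite -lee_fin -lebesgue_stieltjes_itvNyc. Qed.

Lemma cumulativeBounded_le1 (z : R) : F z <= 1.
Proof. by rewrite -lee_fin -lebesgue_stieltjes_itvNyc probability_le1. Qed.

(** Left continuity in the form of a bound: without an atom at [z], [F z] is the mass of []-oo, z[],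
    hence the limit of [F] along [z - n.+1%:R^-1]. *)
Lemma abs_continuous_cdf_le (u z : R) : abs_continuous_cdf F ->
  (forall x, x < z -> F x <= u) -> F z <= u.
Proof.
move=> acF Fu; set mu := lebesgue_stieltjes_measure F.
have muz : mu [set z] = 0.
  apply/(measure0_null_setP mu) => //.
  by apply/acF/measure0_null_setP => //; exact: lebesgue_measure_set1.
pose I (n : nat) : set R := [set` `]-oo, z - n.+1%:R^-1]].
have IE : \bigcup_n I n = `]-oo, z[%classic.
  apply/seteqP; split => x /=.
    move=> [n _]; rewrite /I /= !in_itv/= => /le_lt_trans; apply.
    by rewrite ltrBlDr ltrDl invr_gt0.
  rewrite in_itv/= => /ltr_add_invr[k xz]; exists k => //.
  by rewrite /I /= in_itv/= lerBrDr ltW.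
have muI : (mu (\bigcup_n I n) <= u%:E)%E.
  have : (mu \o I) n @[n --> \oo] --> mu (\bigcup_n I n).
    apply: nondecreasing_cvg_mu; first by move=> n; exact: measurable_itv.
      by rewrite IE; exact: measurable_itv.
    move=> n p np; apply/subsetPset; apply: subset_itvl.
    by rewrite bnd_simp lerD2l lerN2 lef_pV2 ?posrE// ler_nat.
  apply: cvge_le; apply: nearW => n /=.
  by rewrite /mu /I lebesgue_stieltjes_itvNyc lee_fin Fu// ltrBlDr ltrDl invr_gt0.
rewrite -lee_fin -lebesgue_stieltjes_itvNyc -/mu -(setUitv1 true)// -IE.
apply: le_trans (measureU2 _ _ _) _ => //; first by rewrite IE.
by rewrite (_ : _ [set z] = 0) ?adde0.
Qed.

(** The preimage is the supremum of [S]: left continuity bounds [F] there above by [u], right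
    continuity below. *)
Lemma baseline_cdf_surj (u : R) : baseline_cdf F -> 0 <= u < 1 ->
  exists2 z, 0 <= z & F z = u.
Proof.
move=> [acF F0 Fincr] /andP[u0 u1].
pose S := [set x | F x <= u].
(* [F] tends to 1, so [u < 1] is exceeded somewhere; such a [b] bounds [S] from above. *)
have [b ub] : exists b, u < F b.
  have /cvgrPdist_lt/(_ (1 - u)) := cumulativey F.
  rewrite subr_gt0 => /(_ u1) [M [_ FM]]; exists (M + 1).
  have /FM : M < M + 1 by rewrite ltrDl.
  by move=> /(le_lt_trans (ler_norm _)); rewrite ltrD2l ltrN2.
have Fle (x y : R) : x <= y -> F x <= F y.
  by move=> xy; exact: (cumulative_is_nondecreasing F).
have Sb : ubound S b.
  move=> x Sx; rewrite leNgt; apply/negP => bx.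
  by have := le_lt_trans (le_trans (Fle _ _ (ltW bx)) Sx) ub; rewrite ltxx.
have S0 (x : R) : x < 0 -> S x by move=> x0; rewrite /S/= F0.
have supS : has_sup S by split; [exists (-1); apply: S0 | exists b].
have SE (x : R) : x < sup S -> F x <= u.
  move=> xS.
  have /(sup_adherent)/(_ supS)[y Sy] : 0 < sup S - x by rewrite subr_gt0.
  by rewrite subKr => xy; exact: le_trans (Fle _ _ (ltW xy)) Sy.
exists (sup S).
  (* All negative numbers lie in [S], so a negative supremum would be exceeded by its own half. *)
  rewrite leNgt; apply/negP => S_lt0.
  have : sup S / 2 <= sup S.
    by apply: (ub_le_sup (proj2 supS)); apply: S0; rewrite ltr_pdivrMr// mul0r.
  lra.
apply/eqP; rewrite eq_le (abs_continuous_cdf_le acF SE)/=.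
(* Right continuity gives [e'] with [F (sup S + e') <= F (sup S) + e], and [sup S + e'] lies outside
   [S]. *)
apply/ler_addgt0Pr => e e0.
have [e' Fe] := nondecreasing_right_continuousP (sup S) F e0.
apply: le_trans Fe; rewrite leNgt; apply/negP => /ltW Sx.
have := ub_le_sup (proj2 supS) Sx.
by rewrite leNgt ltrDl gt0.
Qed.

(* Extending [F] by the identity below 0, where [F] is constant, yields a map
   that is strictly increasing on the whole line. *)
Definition cdf_scale (z : R) : R := if z < 0 then z else F z.

(** Weak monotonicity needs no baseline hypothesis, so the measurability instance can be declared
    for every [F]. *)
Lemma cdf_scale_nondecreasing : {homo cdf_scale : x y / x <= y}.
Proof.
move=> x y xy; rewrite /cdf_scale; case: (ltP x 0) => x0; case: (ltP y 0) => y0 //.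
- by rewrite (le_trans (ltW x0))// cumulativeBounded_ge0.
- by have := le_trans x0 xy; rewrite leNgt y0.
- exact: (cumulative_is_nondecreasing F).
Qed.

Lemma cdf_scale_mono : baseline_cdf F -> {mono cdf_scale : x y / x <= y}.
Proof.
move=> [_ F0 Fincr]; apply: le_mono => x y xy; rewrite /cdf_scale.
case: (ltP x 0) => x0; case: (ltP y 0) => y0 //.
- by rewrite (lt_le_trans x0)// cumulativeBounded_ge0.
- by have := le_lt_trans x0 xy; rewrite ltNge ltW.
- exact: Fincr.
Qed.

HB.instance Definition _ := @isMeasurableFun.Build _ _ R R cdf_scale
  (nondecreasing_measurable measurableT cdf_scale_nondecreasing).

(** Every [u < 1] is a value [cdf_scale z], and strict monotonicity turns the event that the
    rescaled variable is at most [u] into the event [X <= z]. The resulting cdf involves only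
    [h]. *)
Lemma cdf_cdf_scale (d : measure_display) (T : measurableType d)
    (P : probability T R) (h : R -> R) (X : {RV P >-> R}) :
  baseline_cdf F ->
  (forall z, cdf X z = (vanish_neg (h \o F) z)%:E) ->
  forall u, cdf (cdf_scale \o X : {RV P >-> R}) u =
    (if u < 1 then vanish_neg h u else 1)%:E.
Proof.
move=> bF Xh u; have [acF F0 Fincr] := bF.
have [u1|u1] := ltP u 1; last first.
  rewrite -(probability_setT P); congr (P _); apply/seteqP; split => // w _ /=.
  rewrite in_itv/= /cdf_scale; case: ltP => w0.
    by rewrite (le_trans (ltW w0))// (le_trans ler01).
  exact: le_trans (cumulativeBounded_le1 _) u1.
(* A negative [u] is its own preimage; otherwise surjectivity onto [[0, 1)] applies. *)
have [z zu] : exists2 z, cdf_scale z = u & vanish_neg (h \o F) z = vanish_neg h u.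
  have [u0|u0] := ltP u 0; first by exists u; rewrite /cdf_scale /vanish_neg u0.
  have [|z z0 Fz] := baseline_cdf_surj (u := u) bF; first by rewrite u0.
  by exists z; rewrite /cdf_scale /vanish_neg !ltNge z0 ?u0 /= Fz.
move=> <-; rewrite -Xh; congr (P _); apply/seteqP; split => w /=;
  by rewrite !in_itv/= -zu cdf_scale_mono.
Qed.

End cumulative_bounded.

(** * Distribution-freeness of the ranks *)

Lemma rank_law_free_vanish_neg (R : realType) (m n : nat) (h1 h2 : R -> R) :
  rank_law_free m n (fun F => vanish_neg (h1 \o F)) (fun F => vanish_neg (h2 \o F)).
Proof.
move=> F F' bF bF' d T P Z [iZ Z1 Z2] d' T' P' Z' [iZ' Z1' Z2'] A mA.
(* An event on the ranks is an event on the rescaled joint vector, through a map that does not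
   involve [G]. *)
have rankE (G : cumulativeBounded (0 : R) (1 : R)) (d0 : measure_display)
    (S : measurableType d0) (Q : probability S R) (Y : 'I_(m + n) -> {RV Q >-> R}) :
    baseline_cdf G -> distribution Q (rank_vector Y) A =
    distribution Q (joint (fun i => cdf_scale G \o Y i : {RV Q >-> R}))
      (@rank_tuple R (m + n) @^-1` A).
  move=> bG; rewrite (_ : distribution _ _ _ = Q (rank_vector Y @^-1` A))//.
  rewrite -(rank_vector_mono Y (cdf_scale_mono bG)) rank_vector_joint.
  by rewrite comp_preimage.
rewrite (rankE F)// (rankE F')//; apply: joint_law_eq.
- exact: mutually_independent_comp.
- exact: mutually_independent_comp.
- move=> i u; case: (split_ordP i) => j ->.
    by rewrite (cdf_cdf_scale bF (Z1 j)) (cdf_cdf_scale bF' (Z1' j)).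
  by rewrite (cdf_cdf_scale bF (Z2 j)) (cdf_cdf_scale bF' (Z2' j)).
- by rewrite -[X in measurable X]setTI; exact: measurable_rank_tuple.
Qed.

Lemma rank_law_free_null (R : realType) (m n : nat) :
  @rank_law_free R m n (fun F => F) (fun F => F).
Proof.
have FE (F : cumulativeBounded (0 : R) (1 : R)) : baseline_cdf F ->
    F = vanish_neg (id \o F) :> (R -> R).
  move=> [_ F0 _]; apply/funext => z; rewrite /vanish_neg.
  by case: ifP => // /F0.
move=> F F' bF bF' d T P Z sZ d' T' P' Z' sZ'.
apply: (rank_law_free_vanish_neg (h1 := id) (h2 := id) bF bF').
  by rewrite -FE.
by rewrite -FE.
Qed.

Lemma rank_law_free_alt (R : realType) (m n : nat) (a : alternative) (Delta : R) :
  @rank_law_free R m n (alt_G1 a Delta) (alt_G2 a Delta).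
Proof.
case: a; [
  apply: (rank_law_free_vanish_neg (h1 := id)
    (h2 := fun t => (1 - Delta) * t + Delta * t ^+ 2)) |
  apply: (rank_law_free_vanish_neg (h1 := fun t => 1 - (1 - t) `^ (1 + Delta))
    (h2 := fun t => t `^ (1 + Delta))) |
  apply: (rank_law_free_vanish_neg (h1 := id) (h2 := fun t => t `^ (1 + Delta)))].
Qed.

(** * Power of rank tests *)

(** The type is countable and its singletons are measurable. Consequently every test function is
    measurable. *)
Lemma measurable_tuple_nat (N : nat) (A : set (N.-tuple nat)) : measurable A.
Proof.
apply: countable_measurable; last exact: countableP.
move=> t; rewrite (_ : [set t] = \bigcap_(i in [set: 'I_N])
    ((fun x : N.-tuple nat => tnth x i) @^-1` [set tnth t i])); last first.
  apply/seteqP; split => x /= => [-> //|xt]; apply: eq_from_tnth => i; exact: xt.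
apply: fin_bigcap_measurable => // i _.
by rewrite -[X in measurable X]setTI; exact: measurable_tnth.
Qed.

Section rank_test_expectation.
Context (R : realType) (N : nat) (phi : N.-tuple nat -> R).
Hypothesis test_phi : rank_test phi.

(** Change of variables: the power depends on the sample only through the law of the ranks. *)
Lemma rank_test_expectationE (d : measure_display) (T : measurableType d)
    (P : probability T R) (X : {RV P >-> N.-tuple nat}) :
  ('E_P[phi \o X] = \int[distribution P X]_r (phi r)%:E)%E.
Proof.
rewrite unlock ge0_integral_distribution//.
  by move=> _ B mB; exact: measurable_tuple_nat.
by move=> r; rewrite lee_fin; case/andP: (test_phi r).
Qed.

Lemma rank_test_expectation_fin_num (d : measure_display) (T : measurableType d)
    (P : probability T R) (X : {RV P >-> N.-tuple nat}) :
  ('E_P[phi \o X])%E \is a fin_num.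
Proof.
rewrite ge0_fin_numE; last first.
  by apply: expectation_ge0 => w; case/andP: (test_phi (X w)).
apply: (@le_lt_trans _ _ 1%E); last exact: ltry.
rewrite -(expectation_cst P 1); apply: expectation_le => //.
- by apply: measurableT_comp => // _ B mB; exact: measurable_tuple_nat.
- by move=> w; case/andP: (test_phi (X w)).
- by apply: aeW => w; case/andP: (test_phi (X w)).
Qed.

End rank_test_expectation.

Theorem mainTheorem2 (R : realType) (m n : nat) (hm : (1 <= m)%N) (hn : (1 <= n)%N) :
  [/\ @rank_law_free R m n (fun F => F) (fun F => F),
      forall (a : alternative) (Delta : R), alt_range a Delta ->
        @rank_law_free R m n (alt_G1 a Delta) (alt_G2 a Delta) &
      forall (a : alternative) (phi : (m + n).-tuple nat -> R), rank_test phi ->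
        exists beta : R -> R, forall F : cumulativeBounded (0%R : R) (1%R : R),
          baseline_cdf F -> power_function phi a F beta].
Proof.
split; [exact: rank_law_free_null|by move=> *; exact: rank_law_free_alt|].
move=> a phi test_phi.
(* The powers attained at [Delta] by any baseline [F] and any sample. [beta] selects one of them,
   with default 0 if no sample exists; equality of the rank laws makes the choice immaterial. *)
pose powers (Delta e : R) := exists (F : cumulativeBounded (0 : R) (1 : R))
  (d : measure_display) (T : measurableType d) (P : probability T R)
  (Z : 'I_(m + n) -> {RV P >-> R}),
  [/\ baseline_cdf F, two_sample (alt_G1 a Delta F) (alt_G2 a Delta F) Z &
      ('E_P[phi \o rank_vector Z] = e%:E)%E].
exists (fun Delta => xget 0 (powers Delta)) => F bF Delta _ d T P Z sZ.
have : powers Delta (fine 'E_P[phi \o rank_vector Z])%E.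
  by exists F, d, T, P, Z; rewrite fineK// rank_test_expectation_fin_num.
(* The selected value is itself the power for some [F'] and [Z'], so two rank laws remain to be
   compared. *)
move=> /(xgetI 0) [F' [d' [T' [P' [Z' [bF' sZ' <-]]]]]].
rewrite !rank_test_expectationE//; apply: eq_measure_integral => A mA _.
exact: (rank_law_free_alt bF bF' sZ sZ').
Qed.
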